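(* Let $(\mathsf B,\mathscr B)$ and $(\mathsf S,\mathscr S)$ be measurable spaces with $\mathsf B\subset\mathbb R$ carrying its Borel $\sigma$-algebra, let $\mathsf X=\mathsf B\times\mathsf S$, let $Q$ be a stochastic kernel on $\mathsf B$, $P$ a stochastic kernel on $\mathsf S$, and $\pi(s)=\max_{k,\ell}\{a(s)f(k,\ell)-w\ell-rk\}$ the profit function, regarded also as a function on $\mathsf X$ via $\pi(b,s)=\pi(s)$. Assume: (i) $\mathsf B\subset[b_1,b_2]\subset(0,\infty)$; (ii) $\pi\in bm\mathsf X$ and $\pi_0:=\inf_{s\in\mathsf S}\pi(s)>0$; (iii) $\int\pi(s')P(s,ds')\le\alpha\pi(s)+\lambda$ for all $s\in\mathsf S$, for some positive constants $\alpha,\lambda$ satisfying $\alpha+\lambda/\pi_0<1/b_2$. Let $(Kf)(b,s)=\int\int b'f(b',s')\,Q(b,db')\,P(s,ds')$, $Sv=\pi+Kv$, $e(b,s)=\frac{b_2}{b}\pi(s)$ and $\rho=b_2(\alpha+\lambda/\pi_0)\in[0,1)$. Then (i) there exists a $v^*\in bm\mathsf X$ that solves the data valuation problem, i.e. $v^*=\pi+Kv^*$ on $\mathsf X$, and (ii) $S^nv\stackrel{o}{\to}v^*$ for any $v\in[-e/(1-\rho),e/(1-\rho)]\subset bm\mathsf X$.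
   Context: $bm\mathsf X$ is the space of bounded real-valued measurable functions on $\mathsf X$ (product $\sigma$-algebra), with the pointwise partial order $\le$; it is a countably Dedekind complete Riesz space. $[u,w]=\{v\in bm\mathsf X:u\le v\le w\}$. $v_n\stackrel{o}{\to}v$ (order convergence) means there is a sequence $(d_n)$ in $bm\mathsf X$, decreasing with infimum $0$, such that $|v_n-v|\le d_n$ for all $n$. Here $a:\mathsf S\to\mathbb R_+$ is measurable, $f$ is a production function of capital $k$ and labor $\ell$, $w$ and $r$ are constants (wage rate and rental rate of capital), and the maximum defining $\pi$ is assumed to exist. $\mathsf B$ is the set of discount factor values and $\mathsf S$ the set of values of the stock of data. A solution to the data valuation problem is a function $v\in\mathbb R^{\mathsf X}$ with $v=\pi+Kv$ on $\mathsf X$. *)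

(* Defs.v *)
From HB Require Import structures.
From mathcomp Require Import all_boot all_order all_algebra.
From mathcomp Require Import all_classical all_reals all_analysis.

Set Implicit Arguments.
Unset Strict Implicit.
Unset Printing Implicit Defensive.

Import Order.TTheory GRing.Theory Num.Theory.
Import numFieldNormedType.Exports.

Local Open Scope classical_set_scope.
Local Open Scope ring_scope.

(* A subset of the real line with the trace of the Borel sigma-algebra.  [B]
   itself is not required to be a Borel set; nonemptiness is needed because
   every measurableType is pointed. *)
Definition borel_subset (R : realType) (B : set R) (B0 : B !=set0) : Type :=
  set_type B.

Section borel_subset.
Context (R : realType) (B : set R) (B0 : B !=set0).

HB.instance Definition _ := Choice.on (borel_subset B0).
HB.instance Definition _ :=
  isPointed.Build (borel_subset B0) (SigSub (mem_set (projT2 (cid B0)))).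

Definition bval (b : borel_subset B0) : R := set_val b.

HB.instance Definition _ :=
  Measurable.copy (borel_subset B0) (g_sigma_algebra_preimageType bval).

End borel_subset.

(* The Riesz space bmX, as a set of functions; [u, w] and order convergence are
   relative to it. *)
Section bounded_measurable.
Context (d : measure_display) (X : measurableType d) (R : realType).
Implicit Types (f g u v w : X -> R) (s : nat -> X -> R).

Definition le_fun f g : Prop := forall x, f x <= g x.

Definition bm : set (X -> R) :=
  [set f : X -> R | measurable_fun [set: X] f /\ bounded_fun f].

Definition bm_itv u w : set (X -> R) :=
  [set v : X -> R | bm v /\ le_fun u v /\ le_fun v w].

(* Infimum in the partially ordered set bmX (not the pointwise infimum). *)
Definition bm_is_inf (A : set (X -> R)) g : Prop :=
  [/\ bm g, (forall f, A f -> le_fun g f)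
    & forall h, bm h -> (forall f, A f -> le_fun h f) -> le_fun h g].

Definition order_cvg s v : Prop :=
  [/\ forall n, bm (s n), bm v
    & exists delta : nat -> X -> R,
      [/\ forall n, bm (delta n),
          forall n, le_fun (delta n.+1) (delta n),
          bm_is_inf (range delta) (cst 0)
        & forall n, le_fun (fun x => `|s n x - v x|) (delta n)]].

End bounded_measurable.

Section data_valuation.
Context (R : realType) (d : measure_display) (ST : measurableType d).

(* Capital [k] and labor [l] range over the nonnegative reals. *)
Definition profits (a : ST -> R) (f : R -> R -> R) (w r : R) (s : ST) : set R :=
  [set a s * f kl.1 kl.2 - w * kl.2 - r * kl.1
    | kl in [set kl : R * R | 0 <= kl.1 /\ 0 <= kl.2]].

Definition is_max (A : set R) (m : R) : Prop := A m /\ ubound A m.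

Context (B : set R) (B0 : B !=set0).
Context (Q : R.-pker (borel_subset B0) ~> (borel_subset B0)).
Context (P : R.-pker ST ~> ST).
Implicit Types v : borel_subset B0 * ST -> R.

Definition valK v (x : borel_subset B0 * ST) : R :=
  \int[P x.2]_s' \int[Q x.1]_b' (bval b' * v (b', s')).

Definition valS (pi : ST -> R) v (x : borel_subset B0 * ST) : R :=
  pi x.2 + valK v x.

Definition solves_data_valuation (pi : ST -> R) v : Prop :=
  forall x, v x = pi x.2 + valK v x.

End data_valuation.

(* Main.v *)
(** Since [b <= b2] gives [pi <= e], the drift condition and [pi >= pi0] turn
    [|v| <= c e] into [|Kv| <= c b2 (alpha pi + lambda) <= rho c pi <= rho c e]:
    [K] is a [rho]-contraction for the [e]-weighted sup norm.  Hence [S] maps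
    the ball [|v| <= e / (1 - rho)] into itself, the iterates [S^n 0] converge
    pointwise to a fixed point [v*], and [|S^n v - v*|] is at most a constant
    times [rho^n], which decreases to [0].  That [K] preserves [bmX] needs the
    joint measurability of the inner integral, obtained by viewing [Q] and [P]
    as kernels on product spaces. *)

Require Import Defs.
From HB Require Import structures.
From mathcomp Require Import all_boot all_order all_algebra.
From mathcomp Require Import all_classical all_reals all_analysis.
From mathcomp Require Import measurable_realfun lra ring.

Set Implicit Arguments.
Unset Strict Implicit.
Unset Printing Implicit Defensive.

Import Order.TTheory GRing.Theory Num.Theory.
Import numFieldNormedType.Exports.

Local Open Scope classical_set_scope.
Local Open Scope ring_scope.

(** * Bounded measurable functions and their integrals against a measure of mass one *)

Section bm_theory.
Context (R : realType) (d : measure_display) (X : measurableType d).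
Implicit Types f g : X -> R.

Lemma bmP f :
  bm f <-> measurable_fun [set: X] f /\ exists M, forall x, `|f x| <= M.
Proof.
split=> -[mf bf]; split=> //.
  have [M [_ /(_ (M + 1))]] := bf.
  by rewrite ltrDl ltr01 => /(_ isT) H; exists (M + 1) => x; exact: H.
have [M fM] := bf; exists M; split; first exact: num_real.
by move=> y /ltW My x _; exact: le_trans (fM x) My.
Qed.

Lemma bm_cst (c : R) : bm (cst c : X -> R).
Proof. by apply/bmP; split; [exact: measurable_cst|exists `|c|]. Qed.

Lemma bmD f g : bm f -> bm g -> bm (f \+ g).
Proof.
move=> /bmP[mf [M fM]] /bmP[mg [N gN]]; apply/bmP.
split; first exact: measurable_funD.
by exists (M + N) => x; rewrite (le_trans (ler_normD _ _))// lerD.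
Qed.

Lemma bmB f g : bm f -> bm g -> bm (f \- g).
Proof.
move=> /bmP[mf [M fM]] /bmP[mg [N gN]]; apply/bmP.
split; first exact: measurable_funB.
by exists (M + N) => x; rewrite (le_trans (ler_normB _ _))// lerD.
Qed.

Lemma bmM f g : bm f -> bm g -> bm (f \* g).
Proof.
move=> /bmP[mf [M fM]] /bmP[mg [N gN]]; apply/bmP.
split; first exact: measurable_funM.
by exists (M * N) => x; rewrite normrM ler_pM.
Qed.

Context (mu : {measure set X -> \bar R}) (mu1 : mu [set: X] = 1%E).

Lemma bm_integrable f : bm f -> mu.-integrable [set: X] (EFin \o f).
Proof.
by move=> [mf bf]; apply: measurable_bounded_integrable; rewrite ?mu1 ?ltry.
Qed.

Lemma norm_Rintegral_le f g : bm f -> bm g -> (forall x, `|f x| <= g x) ->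
  `|\int[mu]_x f x| <= \int[mu]_x g x.
Proof.
move=> bmf bmg fg; apply: le_trans.
  by apply: le_normr_Rintegral => //; exact: bm_integrable.
apply: le_Rintegral => //; last exact: bm_integrable.
apply: (bm_integrable (f := fun x => `|f x|)); case/bmP: bmf => mf [M fM].
apply/bmP; split; first exact: measurableT_comp.
by exists M => x; rewrite normr_id.
Qed.

Lemma prob_Rintegral_cst (c : R) : \int[mu]_x c = c.
Proof. by rewrite Rintegral_cst// mu1 mulr1. Qed.

End bm_theory.

Lemma bm_comp (R : realType) (d d' : measure_display) (X : measurableType d)
    (Y : measurableType d') (h : Y -> X) (f : X -> R) :
  measurable_fun [set: Y] h -> bm f -> bm (f \o h).
Proof.
move=> mh /bmP[mf [M fM]]; apply/bmP.
split; first exact: measurableT_comp.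
by exists M => y; exact: fM.
Qed.

(** * Reparametrised kernels and the bounded measurability of kernel integrals *)

Section kernel_pullback.
Context (R : realType) (d dY dZ : measure_display) (X : measurableType d)
  (Y : measurableType dY) (Z : measurableType dZ) (k : R.-pker X ~> Y)
  (h : Z -> X) (mh : measurable_fun [set: Z] h).

(** The measurability proof is an argument so that the kernel instances below can be attached to
    [kpull mh]. *)
Definition kpull of measurable_fun [set: Z] h :
    Z -> {measure set Y -> \bar R} :=
  fun z => k (h z).

Let kpull_measurable U : measurable U ->
  measurable_fun [set: Z] (kpull mh ^~ U).
Proof.
by move=> mU; exact: (measurableT_comp (measurable_kernel k U mU) mh).
Qed.

HB.instance Definition _ :=
  isKernel.Build _ _ _ _ _ (kpull mh) kpull_measurable.

Let kpull_prob z : kpull mh z [set: Y] = 1%E.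
Proof. exact: prob_kernel. Qed.

HB.instance Definition _ :=
  Kernel_isProbability.Build _ _ _ _ _ (kpull mh) kpull_prob.

End kernel_pullback.

Lemma bm_Rintegral_kernel (R : realType) (d dY : measure_display)
    (X : measurableType d) (Y : measurableType dY) (k : R.-pker X ~> Y)
    (g : X * Y -> R) :
  bm g -> bm (fun x => \int[k x]_y g (x, y)).
Proof.
move=> bmg; have [mg [M gM]] := (bmP g).1 bmg.
have bmgx x : bm (fun y => g (x, y)).
  by apply: bm_comp bmg; exact: measurable_pair1.
apply/bmP; split; last first.
  exists M => x.
  rewrite -[leRHS](prob_Rintegral_cst (prob_kernel (s := k) x) M).
  apply: norm_Rintegral_le => //; first exact: prob_kernel.
  exact: bm_cst.
(* Shift by [M]: measurability of a kernel integral is known for nonnegative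
   integrands. *)
have -> : (fun x => \int[k x]_y g (x, y)) =
    (fun x => fine (\int[k x]_y (g (x, y) + M)%:E) - M).
  apply/funext => x; rewrite -[LHS](addrK M); congr (_ - _).
  rewrite -[X in _ + X](prob_Rintegral_cst (prob_kernel (s := k) x)).
  rewrite -RintegralD//.
  - by apply: bm_integrable => //; exact: prob_kernel.
  - by apply: bm_integrable; [exact: prob_kernel|exact: bm_cst].
apply: measurable_funB => //; apply: measurableT_comp => //.
apply: (measurable_fun_integral_finite_kernel (fun z => (g z + M)%:E) k).
- by move=> z; rewrite lee_fin; have := gM z; rewrite ler_norml; lra.
- by apply/measurable_EFinP; exact: measurable_funD.
Qed.

(** The integrand may depend on all of [z] while the kernel sees only [h z]; [Q] and [P] each read
    one coordinate of the state in this way. *)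
Lemma bm_Rintegral_kernel_comp (R : realType) (d dY dZ : measure_display)
    (X : measurableType d) (Y : measurableType dY) (Z : measurableType dZ)
    (k : R.-pker X ~> Y) (h : Z -> X) (g : Z * Y -> R) :
  measurable_fun [set: Z] h ->
  bm g -> bm (fun z => \int[k (h z)]_y g (z, y)).
Proof. by move=> mh bmg; exact: (bm_Rintegral_kernel (kpull k mh) bmg). Qed.

(** * Affine maps that contract a weighted sup norm *)

Section weighted_contraction.
Context (R : realType).

Lemma geometric_le0 (c rho y : R) : 0 <= rho < 1 ->
  (forall n, y <= c * rho ^+ n) -> y <= 0.
Proof.
move=> /andP[rho0 rho1] yc.
have cv : (geometric c rho n) @[n --> \oo] --> 0.
  by apply: cvg_geometric; rewrite ger0_norm.
by apply: (cvgr_to_ge cv); exact: nearW.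
Qed.

Lemma geometric_cauchy_cvg (c rho : R) (u : nat -> R) : 0 <= rho < 1 ->
  (forall n m, `|u (n + m)%N - u n| <= c * rho ^+ n) -> cvgn u.
Proof.
move=> rho01 uc; apply/cauchy_cvgP; apply: cauchy_exP => eps eps0.
(* Otherwise [eps] would lie below the whole geometric sequence, hence be nonpositive. *)
have [N cN] : exists N, c * rho ^+ N < eps.
  apply: contrapT => /forallNP H; have : eps <= 0.
    by apply: (@geometric_le0 c rho) => // n; rewrite leNgt; exact/negP.
  by rewrite leNgt eps0.
exists (u N), N => // n /= Nn; rewrite /ball/= distrC.
by apply: le_lt_trans cN; rewrite -(subnKC Nn); exact: uc.
Qed.

Context (d : measure_display) (X : measurableType d) (K : (X -> R) -> X -> R)
  (p e : X -> R) (rho C M : R).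
Hypothesis rho01 : 0 <= rho < 1.
Hypothesis e_bounded : forall x, 0 <= e x <= M.
Hypothesis bmp : bm p.
Hypothesis p_le : forall x, `|p x| <= C * e x.
Hypothesis bmK : forall v, bm v -> bm (K v).
Hypothesis KB : forall v w, bm v -> bm w -> K (v \- w) = K v \- K w.
Hypothesis K_contract : forall v c, bm v ->
  (forall x, `|v x| <= c * e x) -> forall x, `|K v x| <= rho * c * e x.

Let S v x := p x + K v x.
(** The radius solving [D = C + rho * D], which makes the ball [|v| <= D * e] invariant under
    [S]. *)
Let D := C / (1 - rho).

Let bmS v : bm v -> bm (S v).
Proof. by move=> bmv; apply: bmD => //; exact: bmK. Qed.

Let bm_iter v n : bm v -> bm (iter n S v).
Proof. by move=> bmv; elim: n => //= n; exact: bmS. Qed.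

Let S_contract v w c : bm v -> bm w -> (forall x, `|v x - w x| <= c * e x) ->
  forall x, `|S v x - S w x| <= rho * c * e x.
Proof.
move=> bmv bmw vw x; have -> : S v x - S w x = K (v \- w) x.
  by rewrite KB// /S/=; ring.
by apply: K_contract => //; exact: bmB.
Qed.

Let iter_contract v w c n : bm v -> bm w ->
  (forall x, `|v x - w x| <= c * e x) ->
  forall x, `|iter n S v x - iter n S w x| <= c * rho ^+ n * e x.
Proof.
move=> bmv bmw vw; elim: n => [|n IHn] x; first by rewrite expr0 mulr1.
rewrite exprS mulrCA; apply: S_contract => //; exact: bm_iter.
Qed.

Let S_stable v : bm v -> (forall x, `|v x| <= D * e x) ->
  forall x, `|S v x| <= D * e x.
Proof.
move=> bmv vD x; rewrite (le_trans (ler_normD _ _))//.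
have -> : D * e x = C * e x + rho * D * e x.
  by rewrite /D; field; move: rho01; lra.
by apply: lerD => //; exact: K_contract.
Qed.

Let iter_stable v n : bm v -> (forall x, `|v x| <= D * e x) ->
  forall x, `|iter n S v x| <= D * e x.
Proof.
by move=> bmv vD; elim: n => //= n IHn; apply: S_stable => //; exact: bm_iter.
Qed.

Lemma weighted_contraction : exists2 vstar : X -> R,
  bm vstar /\ (forall x, vstar x = p x + K vstar x)
  & forall v, bm v -> (forall x, `|v x| <= C / (1 - rho) * e x) ->
      order_cvg (fun n => iter n (fun w x => p x + K w x) v) vstar.
Proof.
rewrite -/D -/S; have [rho0 rho1] := andP rho01.
have e0 x : 0 <= e x by case/andP: (e_bounded x).
have eM x : e x <= M by case/andP: (e_bounded x).
have D0 x : 0 <= D * e x.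
  have C0 : 0 <= C * e x := le_trans (normr_ge0 _) (p_le x).
  by rewrite /D mulrAC mulr_ge0// invr_ge0; lra.
pose u n := iter n S (cst 0 : X -> R).
have bm0 : bm (cst 0 : X -> R) := bm_cst X 0.
have bmu n : bm (u n) by exact: bm_iter.
have uD n x : `|u n x| <= D * e x.
  by apply: iter_stable => // y; rewrite normr0.
(* Since [u (n + m)] is [S^n] applied to [u m], this compares the [n]-th iterates of [u m] and [0],
   which start at distance at most [D * e]. *)
have u_cauchy n m x : `|u (n + m)%N x - u n x| <= D * rho ^+ n * e x.
  rewrite /u iterD; apply: iter_contract => [|//|y]; first exact: bmu.
  by rewrite subr0; exact: uD.
have u_cvg x : cvgn (u ^~ x).
  by apply: (@geometric_cauchy_cvg (D * e x) rho) => // n m; rewrite mulrAC.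
pose vs x := limn (u ^~ x).
(* Pass to the limit in the Cauchy estimate along the larger index, with [n] fixed. *)
have vs_u n x : `|vs x - u n x| <= D * rho ^+ n * e x.
  have cv : `|u k x - u n x| @[k --> \oo] --> `|vs x - u n x|.
    by apply: cvg_norm; apply: cvgB; [exact: u_cvg|exact: cvg_cst].
  apply: (cvgr_to_le cv); exists n => // k /= nk.
  by rewrite -(subnKC nk).
have vsD x : `|vs x| <= D * e x.
  by have := vs_u 0%N x; rewrite subr0 expr0 mulr1.
have Dsup x : D * e x <= `|D| * M.
  apply: le_trans (ler_wpM2l (normr_ge0 D) (eM x)).
  exact: ler_wpM2r (e0 x) _ _ (ler_norm D).
have bmvs : bm vs.
  apply/bmP; split.
    by apply: (@measurable_fun_cvg _ _ _ _ u) => [n|x _]; [case: (bmu n)|].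
  by exists (`|D| * M) => x; exact: le_trans (vsD x) (Dsup x).
have vsE x : vs x = S vs x.
  apply/eqP; rewrite -subr_eq0 -normr_le0.
  (* Go through [u n.+1 = S (u n)]: its distances to [vs] and to [S vs] are each at most
     [D * rho ^+ n.+1 * e x]. *)
  apply: (@geometric_le0 (2 * (D * e x) * rho) rho) => // n.
  rewrite (le_trans (ler_distD (u n.+1 x) _ _))//.
  have -> : 2 * (D * e x) * rho * rho ^+ n =
      D * rho ^+ n.+1 * e x + rho * (D * rho ^+ n) * e x by rewrite exprS; ring.
  apply: lerD => //; rewrite distrC; exact: S_contract.
exists vs; first by split.
move=> v bmv vD.
have iter_vs n : iter n S vs = vs.
  by elim: n => //= n ->; apply/funext => x; rewrite -vsE.
(* Two elements of the invariant ball differ by at most [2 * D * e x], hence by at most [c]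
   uniformly in [x], so constant functions can dominate the error. *)
pose c := 2 * (`|D| * M).
have c0 : X -> 0 <= c by move=> x; rewrite /c mulr_ge0// (le_trans _ (Dsup x)).
split=> //; first by move=> n; exact: bm_iter.
exists (fun n => cst (c * rho ^+ n)); split.
- by move=> n; exact: bm_cst.
- move=> n x /=; rewrite exprS; apply: ler_wpM2l; first exact: c0.
  by rewrite ler_piMl ?exprn_ge0// ltW.
- split; first exact: bm_cst.
    by move=> _ [n _ <-] x /=; rewrite mulr_ge0 ?exprn_ge0//; exact: c0.
  move=> h _ hle x /=; apply: (@geometric_le0 c rho) => // n.
  by apply: (hle (cst (c * rho ^+ n))); exists n.
(* Writing [vs] as its own [n]-th iterate turns the error into a difference of two [n]-th
   iterates. *)
- move=> n x /=; rewrite -[in vs x](iter_vs n).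
  apply: (@le_trans _ _ (2 * D * rho ^+ n * e x)).
    apply: iter_contract => // y; rewrite (le_trans (ler_normB _ _))//.
    by rewrite -mulrA mulr2n mulrDl mul1r lerD.
  rewrite /c mulrAC -!mulrA ler_wpM2l// !mulrA ler_wpM2r ?exprn_ge0//.
Qed.

End weighted_contraction.

(** * The discounted expectation operator on bounded measurable functions *)

Section data_valuation_operator.
Context (R : realType) (B : set R) (B0 : B !=set0) (b2 : R).
Hypothesis B_itv : forall b : borel_subset B0, 0 < bval b <= b2.

Lemma bm_bval : bm (@bval R B B0).
Proof.
apply/bmP; split.
  by move=> _ U mU; rewrite setTI; exists U; rewrite ?setTI.
by exists b2 => b; have /andP[b0 bb2] := B_itv b; rewrite ger0_norm// ltW.
Qed.

Context (d : measure_display) (ST : measurableType d).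
Context (Q : R.-pker (borel_subset B0) ~> (borel_subset B0)).
Context (P : R.-pker ST ~> ST).
Implicit Types v w : borel_subset B0 * ST -> R.

(** The first coordinate of [z] is the current discount factor, the second the next stock of data,
    which [P] integrates out afterwards. *)
Let inner v (z : borel_subset B0 * ST) : R :=
  \int[Q z.1]_b' (bval b' * v (b', z.2)).

Let bm_integrand v : bm v -> bm (fun z => bval z.1 * v z).
Proof.
move=> bmv; apply: (bmM (f := @bval R B B0 \o fst)) => //.
exact: bm_comp bm_bval.
Qed.

Let bm_integrand_section v (s : ST) : bm v ->
  bm (fun b : borel_subset B0 => bval b * v (b, s)).
Proof.
move=> bmv; apply: (bm_comp (h := fun b => (b, s))) (bm_integrand bmv).
exact: measurable_pair2.
Qed.

Let bm_inner v : bm v -> bm (inner v).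
Proof.
move=> bmv; apply: (bm_Rintegral_kernel_comp Q
  (g := fun zb : borel_subset B0 * ST * borel_subset B0 =>
    bval zb.2 * v (zb.2, zb.1.2)) measurable_fst).
apply: (bm_comp
  (h := fun zb : borel_subset B0 * ST * borel_subset B0 => (zb.2, zb.1.2)))
  (bm_integrand bmv).
by apply: measurable_fun_pair => //; exact: measurableT_comp.
Qed.

Let bm_inner_section v b : bm v -> bm (fun s : ST => inner v (b, s)).
Proof.
by move=> /bm_inner; apply: (bm_comp (h := pair b)); exact: measurable_pair1.
Qed.

(* Unqualified, [valK] would be the lemma of [eqtype]. *)
Lemma bm_valK v : bm v -> bm (Defs.valK Q P v).
Proof.
move=> bmv; apply: (bm_Rintegral_kernel_comp P
  (g := fun zs : borel_subset B0 * ST * ST => inner v (zs.1.1, zs.2))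
  measurable_snd).
apply: (bm_comp
  (h := fun zs : borel_subset B0 * ST * ST => (zs.1.1, zs.2))) (bm_inner bmv).
by apply: measurable_fun_pair => //; exact: measurableT_comp.
Qed.

Lemma valKB v w : bm v -> bm w ->
  Defs.valK Q P (v \- w) = Defs.valK Q P v \- Defs.valK Q P w.
Proof.
move=> bmv bmw; apply/funext => -[b s]; rewrite /Defs.valK/=.
rewrite -RintegralB//; first last.
- by apply: bm_integrable; [exact: prob_kernel|exact: (bm_inner_section b)].
- by apply: bm_integrable; [exact: prob_kernel|exact: (bm_inner_section b)].
apply: eq_Rintegral => s' _; rewrite -RintegralB//; first last.
- by apply: bm_integrable; [exact: prob_kernel|exact: bm_integrand_section].
- by apply: bm_integrable; [exact: prob_kernel|exact: bm_integrand_section].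
by apply: eq_Rintegral => b' _; rewrite mulrBr.
Qed.

(** The factor [b'] in the integrand cancels the [1 / b'] in the bound on [v]. What remains, [q s'],
    is constant in [b'], so integrating against [Q] leaves it unchanged. *)
Lemma norm_valK_le v (q : ST -> R) : bm v -> bm q ->
  (forall x, `|v x| <= q x.2 / bval x.1) ->
  forall x, `|Defs.valK Q P v x| <= \int[P x.2]_s q s.
Proof.
move=> bmv bmq vq [b s]; apply: norm_Rintegral_le => //=.
- exact: prob_kernel.
- exact: (bm_inner_section b).
move=> s'; rewrite -[leRHS](prob_Rintegral_cst (prob_kernel (s := Q) b)).
apply: norm_Rintegral_le.
- exact: prob_kernel.
- exact: bm_integrand_section.
- exact: bm_cst.
move=> b' /=; have /andP[b'0 _] := B_itv b'.
rewrite normrM gtr0_norm// mulrC -ler_pdivlMr//; exact: vq.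
Qed.

End data_valuation_operator.

(** * Data valuation: the contraction hypotheses from the drift condition *)

Theorem proposition4p9 (R : realType)
  (B : set R) (B0 : B !=set0)
  (d : measure_display) (ST : measurableType d)
  (Q : R.-pker (borel_subset B0) ~> (borel_subset B0))
  (P : R.-pker ST ~> ST)
  (a : ST -> R) (a_ge0 : forall s, 0 <= a s)
  (a_meas : measurable_fun [set: ST] a)
  (f : R -> R -> R) (w r : R)
  (pi : ST -> R) (pi_max : forall s, is_max (profits a f w r s) (pi s))
  (b1 b2 alpha lambda : R)
  (B_sub : B `<=` `[b1, b2]%classic)
  (b_pos : `[b1, b2]%classic `<=` `]0, +oo[%classic)
  (pi_bm : bm (fun x : borel_subset B0 * ST => pi x.2))
  (pi_inf_gt0 : 0 < inf (range pi))
  (alpha_gt0 : 0 < alpha) (lambda_gt0 : 0 < lambda)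
  (drift : forall s, \int[P s]_s' pi s' <= alpha * pi s + lambda)
  (contr : alpha + lambda / inf (range pi) < 1 / b2) :
  let e := fun x : borel_subset B0 * ST => b2 / bval x.1 * pi x.2 in
  let rho := b2 * (alpha + lambda / inf (range pi)) in
  0 <= rho < 1 /\
  exists2 vstar : borel_subset B0 * ST -> R,
    bm vstar /\ solves_data_valuation Q P pi vstar
  & forall v : borel_subset B0 * ST -> R,
      bm_itv (fun x => - e x / (1 - rho)) (fun x => e x / (1 - rho)) v ->
      order_cvg (fun n => iter n (valS Q P pi) v) vstar.
Proof.
move=> e rho; set pi0 := inf (range pi) in pi_inf_gt0 contr rho *.
have Bb (b : borel_subset B0) : b1 <= bval b <= b2.
  by have /= := B_sub _ (set_mem (valP b)); rewrite in_itv.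
(* A point of [B] shows that [[b1, b2]] is nonempty, so that [b_pos] can be applied to [b1]. *)
have b1b2 : b1 <= b2.
  by have /andP[bb1 bb2] := Bb point; exact: le_trans bb1 bb2.
have b1_gt0 : 0 < b1.
  by have := b_pos b1; rewrite /= !in_itv/= lexx b1b2/= andbT => ->.
have B_itv (b : borel_subset B0) : 0 < bval b <= b2.
  by have /andP[bb1 ->] := Bb b; rewrite (lt_le_trans b1_gt0).
have b2_gt0 : 0 < b2 by exact: lt_le_trans b1b2.
have rho01 : 0 <= rho < 1.
  apply/andP; split; last by rewrite /rho mulrC -ltr_pdivlMr.
  by rewrite mulr_ge0 ?(ltW b2_gt0)// addr_ge0 ?divr_ge0// ltW.
(* Restrict to the section at an arbitrary discount factor. *)
have pi_bmS : bm pi.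
  apply: (bm_comp (h := fun s => (point : borel_subset B0, s))) pi_bm.
  exact: measurable_pair1.
have [_ [M piM]] := (bmP pi).1 pi_bmS.
have pi_ge s : pi0 <= pi s.
  apply: ge_inf; last by exists s.
  by exists (- M) => _ [s' _ <-]; have := piM s'; rewrite ler_norml => /andP[].
have pi_gt0 s : 0 < pi s by exact: lt_le_trans (pi_ge s).
have pi_e x : pi x.2 <= e x.
  have /andP[b_gt0 bb2] := B_itv x.1.
  by rewrite /e ler_peMl// ?(ltW (pi_gt0 _))// ler_pdivlMr// mul1r.
split=> //.
(* Here [C = 1] because [pi <= e], and [b2 / b1 * M] bounds [e] because [b >= b1]. *)
have [||||||vs vs_sol vs_cvg] := @weighted_contraction R _ _ (Defs.valK Q P)
    (fun x => pi x.2) e rho 1 (b2 / b1 * M) rho01.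
- move=> x; apply/andP; split; first exact: le_trans (ltW (pi_gt0 _)) (pi_e x).
  have /andP[b_ge1 _] := Bb x.1; have /andP[b_gt0 _] := B_itv x.1.
  apply: ler_pM.
  + by rewrite divr_ge0// ltW.
  + exact: ltW.
  + by rewrite ler_pM2l// lef_pV2 ?posrE.
  + exact: le_trans (ler_norm _) (piM _).
- exact: pi_bm.
- by move=> x; rewrite mul1r gtr0_norm.
- by move=> v; exact: (bm_valK B_itv).
- by move=> v u; exact: (valKB B_itv).
- move=> v c bmv vc x.
  have c_ge0 : 0 <= c.
    have := le_trans (normr_ge0 _) (vc x).
    by rewrite pmulr_lge0// (lt_le_trans (pi_gt0 _) (pi_e x)).
  (* Chosen so that [c * e] equals this function of [s] divided by [b], the form of bound in
     [norm_valK_le]. *)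
  have bmq : bm (fun s => c * b2 * pi s) by exact: (bmM (bm_cst _ _)).
  apply: le_trans (norm_valK_le B_itv Q P bmv bmq _ x) _.
    by move=> y; rewrite (le_trans (vc y))// /e; lra.
  rewrite RintegralZl//; last by apply: bm_integrable => //; exact: prob_kernel.
  apply: (@le_trans _ _ (rho * c * pi x.2)); last first.
    by rewrite ler_wpM2l// mulr_ge0//; case/andP: rho01.
  have -> : rho * c * pi x.2 = c * b2 * ((alpha + lambda / pi0) * pi x.2).
    by rewrite /rho; ring.
  rewrite ler_wpM2l ?mulr_ge0 ?(ltW b2_gt0)//.
  (* After the drift bound there remains [lambda <= lambda / pi0 * pi], which follows from
     [pi0 <= pi]. *)
  rewrite (le_trans (drift _))// mulrDl lerD2l -mulrA.
  rewrite ler_peMr ?(ltW lambda_gt0)//.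
  by rewrite mulrC ler_pdivlMr// mul1r.
exists vs => // v [bmv [vl vu]]; apply: vs_cvg => // x.
rewrite ler_norml; apply/andP; split.
- by rewrite (le_trans _ (vl x))// mulNr mul1r mulrC.
- by rewrite (le_trans (vu x))// mul1r mulrC.
Qed.
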